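(* For every pair of integers $t,n\ge 3$ there exists $h(t,n)\in\mathbb{N}$ such that any family of more than $h(t,n)$ convex bodies in the plane contains either a subfamily of $t$ convex bodies having a common transversal line, or a subfamily of $n$ convex bodies in convex position.
   Context: A convex body is a compact convex set in the plane. A transversal line of a family of sets is a line meeting every member of the family. A family $\mathcal{F}$ of sets is in convex position if for every $A\in\mathcal{F}$, $\mathrm{conv}(\bigcup\mathcal{F})\neq \mathrm{conv}(\bigcup(\mathcal{F}\setminus\{A\}))$. *)

(* Defs.v *)
From mathcomp Require Import all_boot all_order all_algebra.
From mathcomp Require Import all_classical all_reals all_analysis.

Set Implicit Arguments.
Unset Strict Implicit.
Unset Printing Implicit Defensive.

Import Order.TTheory GRing.Theory Num.Theory.
Import numFieldNormedType.Exports.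

Local Open Scope classical_set_scope.
Local Open Scope ring_scope.

Section PlaneConvexity.
Variable R : realType.

Notation plane := 'rV[R]_2.

Definition conv_hull (A : set plane) : set plane := smallest (@convex_set R plane) A.

(* The empty set is allowed; the members of a family being pairwise distinct,
   it can occur at most once. *)
Definition convex_body (K : set plane) : Prop :=
  compact K /\ @convex_set R plane K.

Definition is_line (l : set plane) : Prop :=
  exists p v : plane, v != 0 /\ l = [set p + s *: v | s in [set: R]].

Definition transversal_line (F : set (set plane)) (l : set plane) : Prop :=
  is_line l /\ forall A, F A -> l `&` A !=set0.

Definition convex_position (F : set (set plane)) : Prop :=
  forall A, F A ->
    conv_hull (\bigcup_(B in F) B) <> conv_hull (\bigcup_(B in F `\ A) B).

End PlaneConvexity.

(* Main.v *)
(* By Ramsey's theorem on pairs, either t bodies have pairwise meeting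
   projections to the x-axis, hence a vertical transversal by Helly's theorem on
   the line, or many bodies can be listed from left to right with disjoint
   projections. Transversals of such a list respect its order, so Hadwiger's
   theorem applies: t bodies, any three of which have a transversal, have a common
   one. By Ramsey's theorem on triples we may thus assume that no three bodies
   have a transversal. All triples of points taken from three given bodies then
   have the same orientation, and one more application of Ramsey's theorem gives
   n bodies with a single orientation throughout: they form a convex or concave
   chain, hence are in convex position. *)
Require Import Defs.
From mathcomp Require Import all_boot all_order all_algebra.
From mathcomp Require Import all_classical all_reals all_analysis.
From mathcomp Require Import ring lra.

Set Implicit Arguments.
Unset Strict Implicit.
Unset Printing Implicit Defensive.

Import Order.TTheory GRing.Theory Num.Theory.
Import numFieldNormedType.Exports.

Local Open Scope classical_set_scope.
Local Open Scope card_scope.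
Local Open Scope ring_scope.

(** * Ramsey's theorem for subsequences *)

(** The [k]-subsets are encoded as subsequences, so that a colouring may depend on the order in
    which the members are listed. *)
Definition homogeneous (T : eqType) (k : nat) (P : pred (seq T)) (s : seq T) :=
  forall u, subseq u s -> size u = k -> P u.

Lemma homogeneous_sub (T : eqType) k (P : pred (seq T)) u s :
  subseq u s -> homogeneous k P s -> homogeneous k P u.
Proof. by move=> us Ps w wu; apply: Ps; apply: subseq_trans us. Qed.

Lemma homogeneous_cons (T : eqType) k (P : pred (seq T)) x s :
  homogeneous k (fun u => P (x :: u)) s -> homogeneous k.+1 P s ->
  homogeneous k.+1 P (x :: s).
Proof.
move=> Px Ps [|y u]//= us [uk].
by move: us; case: eqP => [-> us|_ us]; [apply: Px | apply: Ps; rewrite //= uk].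
Qed.

(** Induction on [k], then on [a] and [b]. The first element [x] colours [k]-tuples [u] by
    [P (x :: u)]; a long homogeneous list for this colouring is searched with the bound for
    [(a, b.+1)] or [(a.+1, b)], and [x] lengthens the result if it has the matching colour. *)
Lemma ramsey (k a b : nat) : exists N, forall (T : eqType) (P : pred (seq T))
    (s : seq T), (N <= size s)%N ->
  exists2 u, subseq u s &
    (size u = a /\ homogeneous k P u) \/
    (size u = b /\ homogeneous k (predC P) u).
Proof.
elim: k a b => [a b|k IHk].
  exists (maxn a b) => T P s; rewrite geq_max => /andP[aN bN].
  have nilP (Q : pred (seq T)) u : Q [::] -> homogeneous 0 Q u.
    by move=> Q0 w _ /size0nil ->.
  have [P0|P0] := boolP (P [::]).
    exists (take a s); first exact: take_subseq.
    by left; rewrite size_takel//; split=> //; apply: nilP.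
  exists (take b s); first exact: take_subseq.
  by right; rewrite size_takel//; split=> //; apply: nilP.
have nil0 (T : eqType) (Q : pred (seq T)) : homogeneous k.+1 Q [::].
  by move=> u; rewrite subseq0 => /eqP ->.
elim=> [b|a IHa]; first
  by exists 0%N => T P s _; exists [::]; rewrite ?sub0seq//; left.
elim=> [|b [Nb HNb]]; first
  by exists 0%N => T P s _; exists [::]; rewrite ?sub0seq//; right.
have [Na HNa] := IHa b.+1.
have [N HN] := IHk Na Nb.
exists N.+1 => T P [|x s]//= Ns.
have [u us [[uN Pu]|[uN Pu]]] := HN T (fun u => P (x :: u)) s Ns.
  have [|w wu [[wa Pw]|[wb Pw]]] := HNa T P u; first by rewrite uN.
    exists (x :: w); first by rewrite /= eqxx; apply: subseq_trans us.
    left; split; first by rewrite /= wa.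
    by apply: homogeneous_cons => //; apply: homogeneous_sub Pu.
  exists w; last by right.
  exact: subseq_trans (subseq_trans wu us) (subseq_cons _ _).
have [|w wu [[wa Pw]|[wb Pw]]] := HNb T P u; first by rewrite uN.
  exists w; last by left.
  exact: subseq_trans (subseq_trans wu us) (subseq_cons _ _).
exists (x :: w); first by rewrite /= eqxx; apply: subseq_trans us.
right; split; first by rewrite /= wb.
by apply: homogeneous_cons => //; apply: homogeneous_sub Pu.
Qed.

Lemma homogeneous2 (T : eqType) (P : pred (seq T)) u :
  homogeneous 2 P u -> pairwise (fun x y => P [:: x; y]) u.
Proof.
elim: u => //= x u IHu Pu; apply/andP; split.
  by apply/allP => y yu; apply: Pu; rewrite //= eqxx sub1seq.
by apply: IHu; apply: homogeneous_sub Pu; apply: subseq_cons.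
Qed.

(** Stated for any total order, so that the dual order [R^d] yields minima as well. *)
Lemma seq_argmax (d : Order.disp_t) (U : orderType d) (T : eqType) (f : T -> U)
  (s : seq T) x0 : x0 \in s ->
  exists2 x, x \in s & {in s, forall y, (f y <= f x)%O}.
Proof.
elim: s x0 => //= x [|y s] IHs x0 _.
  by exists x; rewrite ?mem_head// => y; rewrite inE => /eqP ->.
have [z zs zmax] := IHs y (mem_head _ _).
have [xz|zx] := leP (f x) (f z).
  exists z; first by rewrite inE zs orbT.
  by move=> w; rewrite inE => /predU1P[->//|]; apply: zmax.
exists x; first exact: mem_head.
move=> w; rewrite inE => /predU1P[->//|/zmax wz].
exact: le_trans wz (ltW zx).
Qed.

Lemma pairwise_sym_in (T : eqType) (r : rel T) (u : seq T) : symmetric r ->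
  {in u, reflexive r} -> pairwise r u -> {in u &, forall x y, r x y}.
Proof.
move=> rC; elim: u => //= z u IHu rxx /andP[/allP zu ru] x y.
rewrite !inE => /predU1P[->|xu] /predU1P[->|yu].
- by rewrite rxx ?mem_head.
- exact: zu.
- by rewrite rC zu.
- by apply: IHu => // w wu; apply: rxx; rewrite inE wu orbT.
Qed.

Lemma card_seq (T : eqType) (u : seq T) : uniq u -> [set` u] #= `I_(size u).
Proof.
case: u => [_|x u' uu]; first by rewrite set_nil II0.
set u := x :: u' in uu *.
have -> : [set` u] = nth x u @` `I_(size u).
  apply/seteqP; split=> y /=; last by move=> [i iu <-]; exact: mem_nth.
  by move=> yu; exists (index y u); [rewrite index_mem|exact: nth_index].
apply: inj_card_eq => i j; rewrite !inE/= => iu ju /eqP.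
by rewrite nth_uniq// => /eqP.
Qed.

Lemma size_filter_neq (T : eqType) (x0 : T) (s : seq T) : uniq s ->
  ((size s).-1 <= size [seq x <- s | x != x0])%N.
Proof.
move=> us; rewrite (_ : [seq x <- s | x != x0] = rem x0 s);
  last by rewrite rem_filter.
by have [xs|xs] := boolP (x0 \in s); [rewrite size_rem|rewrite rem_id// leq_pred].
Qed.

(** * Intervals of the line *)

Section Slopes.
Variable R : realType.
Notation plane := 'rV[R]_2.
Implicit Types (p q r : plane) (A B C D : set plane) (m : R).

(* With [p i j] in the intersection of the i-th and j-th intervals, the point
   [max_i min_j p i j] lies in all of them. *)
Lemma helly1 (T : eqType) (I : T -> set R) (s : seq T) :
  {in s, forall x, is_interval (I x)} ->
  {in s &, forall x y, I x `&` I y !=set0} ->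
  exists z, {in s, forall x, I x z}.
Proof.
move=> itvI meetI; case: s itvI meetI => [_ _|x0 s']; first by exists 0.
set s := _ :: _ => itvI meetI; have x0s : x0 \in s by exact: mem_head.
have [f fP] : exists f : T -> T -> R,
    {in s &, forall x y, I x (f x y) /\ I y (f x y)}.
  have /choice[f fP] : forall xy : T * T, exists z,
      xy.1 \in s -> xy.2 \in s -> I xy.1 z /\ I xy.2 z.
    move=> [x y]/=; have [xs|xs] := boolP (x \in s); last by exists 0.
    have [ys|ys] := boolP (y \in s); last by exists 0.
    by have [z zxy] := meetI _ _ xs ys; exists z.
  by exists (fun x y => f (x, y)) => x y xs ys; apply: (fP (x, y)).
have /choice[g gP] : forall x, exists y,
    y \in s /\ {in s, forall z, f x y <= f x z}.
  move=> x; have [y ys yP] := @seq_argmax _ R^d _ (f x) s x0 x0s.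
  by exists y.
have [x xs xP] := seq_argmax (fun x => f x (g x)) x0s.
(* Maximality of [x] gives [f y (g y) <= f x (g x)], minimality of [g x] gives [f x (g x) <= f x y],
   and both bounds lie in [I y]. *)
exists (f x (g x)) => y ys; apply: (itvI y ys (f y (g y)) (f x y)).
- by have [] := fP _ _ ys (gP y).1.
- by have [] := fP _ _ xs ys.
- by rewrite xP//= (gP x).2.
Qed.

(** If [w <= z], then [y] (when [y <= z]) or [z] (when [z < y]) would lie in both intervals. *)
Lemma interval_lt (I J : set R) x y : is_interval I -> is_interval J ->
  I `&` J = set0 -> I x -> J y -> x < y -> forall z w, I z -> J w -> z < w.
Proof.
move=> iI iJ IJ Ix Jy xy z w Iz Jw; rewrite ltNge; apply/negP => wz.
suff [t [It Jt]] : I `&` J !=set0 by have : (I `&` J) t by []; rewrite IJ.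
have [yz|zy] := leP y z.
  by exists y; split=> //; apply: (iI x z) => //; rewrite ltW.
by exists z; split=> //; apply: (iJ w y) => //; rewrite wz ltW.
Qed.

(* A chordless 4-cycle is not an interval graph. *)
Lemma interval_cycle4 (I1 I2 J1 J2 : set R) :
  is_interval I1 -> is_interval I2 -> is_interval J1 -> is_interval J2 ->
  I1 `&` J1 !=set0 -> I1 `&` J2 !=set0 -> I2 `&` J1 !=set0 -> I2 `&` J2 !=set0 ->
  I1 `&` I2 = set0 -> J1 `&` J2 !=set0.
Proof.
move=> i1 i2 j1 j2 [a [Ia Ja]] [b [Ib Jb]] [c [Ic Jc]] [d [Id Jd]] I0.
case: (ltgtP a c) => [ac|ca|ac].
- have lt12 := interval_lt i1 i2 I0 Ia Ic ac.
  (* Since [a] and [b] precede [c] and [d], the maximum of [a] and [b] lies between [a] and [c] in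
     [J1] and between [b] and [d] in [J2]. *)
  exists (Num.max a b); split; [apply: (j1 a c)|apply: (j2 b d)] => //;
    by rewrite le_max lexx ?orbT/= ge_max !ltW ?lt12.
- rewrite setIC in I0; have lt21 := interval_lt i2 i1 I0 Ic Ia ca.
  exists (Num.max c d); split; [apply: (j1 c a)|apply: (j2 d b)] => //;
    by rewrite le_max lexx ?orbT/= ge_max !ltW ?lt21.
- by suff : set0 a by []; rewrite -I0; split=> //; rewrite ac.
Qed.

(** * Slopes of common transversals *)

Definition fx p : R := p ord0 ord0.
Definition fy p : R := p ord0 ord_max.

Lemma fx_comb a b p q : fx (a *: p + b *: q) = a * fx p + b * fx q.
Proof. by rewrite /fx !mxE. Qed.

Lemma fy_comb a b p q : fy (a *: p + b *: q) = a * fy p + b * fy q.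
Proof. by rewrite /fy !mxE. Qed.

Lemma convex_setE A : @convex_set R plane A <-> forall p q (k : R),
  0 <= k <= 1 -> A p -> A q -> A (k *: p + (1 - k) *: q).
Proof.
split=> [cA p q k k01 Ap Aq|cA p q k]; last first.
  rewrite !inE => Ap Aq; apply: (cA p q k%:num) => //.
  by apply/andP; split.
have /set_mem := cA p q (Itv01 (andP k01).1 (andP k01).2) (mem_set Ap) (mem_set Aq).
by [].
Qed.

Lemma convex_comb (x y z : R) : x <= z <= y ->
  exists2 k, 0 <= k <= 1 & z = k * x + (1 - k) * y.
Proof.
move=> /andP[xz zy]; have [xy|yx] := ltP x y; last first.
  exists 1; first by rewrite ler01 lexx.
  by rewrite subrr mul0r mul1r addr0; apply/eqP; rewrite eq_le xz (le_trans zy).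
have yx0 : 0 < y - x by rewrite subr_gt0.
exists ((y - z) / (y - x)).
  by rewrite divr_ge0 ?subr_ge0 ?(ltW xy)//= ler_pdivrMr// mul1r lerB.
by field; rewrite gt_eqF.
Qed.

Definition affine (f : plane -> R) :=
  forall (k : R) p q, f (k *: p + (1 - k) *: q) = k * f p + (1 - k) * f q.

Lemma affine_itv (f : plane -> R) A :
  affine f -> @convex_set R plane A -> is_interval (f @` A).
Proof.
move=> af /convex_setE cA _ _ [p Ap <-] [q Aq <-] z /convex_comb[k k01 ->].
by exists (k *: p + (1 - k) *: q); [apply: cA | rewrite af].
Qed.

Lemma fx_affine : affine fx. Proof. by move=> k p q; exact: fx_comb. Qed.

(* [b] is in [shadow m A] iff the line [y = m x + b] meets [A]. *)
Definition shadow m A : set R := [set fy p - m * fx p | p in A].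

Lemma shadow_itv m A : @convex_set R plane A -> is_interval (shadow m A).
Proof.
by apply: affine_itv => k p q; rewrite fx_comb fy_comb; ring.
Qed.

Definition slopes A B : set R := [set m | shadow m A `&` shadow m B !=set0].

Lemma slopesC A B : slopes A B = slopes B A.
Proof. by apply/seteqP; split=> m; rewrite /slopes/= setIC. Qed.

(** Nonemptiness makes the relation irreflexive and transitive; otherwise the empty set would
    precede and follow every set. *)
Definition xlt A B := `[< [/\ A !=set0, B !=set0 &
  forall p q, A p -> B q -> fx p < fx q] >].

Lemma xlt_trans : transitive xlt.
Proof.
move=> B A C /asboolP[A0 [b Bb] AB] /asboolP[_ C0 BC]; apply/asboolP; split=> //.
by move=> p q Ap Cq; apply: lt_trans (AB _ _ Ap Bb) (BC _ _ Bb Cq).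
Qed.

Lemma xlt_irr : irreflexive xlt.
Proof.
by move=> A; apply/negP => /asboolP[[p Ap] _ /(_ p p Ap Ap)]; rewrite ltxx.
Qed.

Definition slope p q := (fy q - fy p) / (fx q - fx p).

Lemma slopesE A B : xlt A B ->
  slopes A B = [set slope pq.1 pq.2 | pq in A `*` B].
Proof.
move=> /asboolP[_ _ AB]; apply/seteqP; split=> m.
  move=> [_ [[p Ap <-] [q Bq pq]]]; exists (p, q) => //=.
  have := AB _ _ Ap Bq; rewrite /slope => pq0.
  have -> : fy q - fy p = m * (fx q - fx p).
    by apply/eqP; rewrite -subr_eq0; apply/eqP; move: pq; lra.
  by rewrite mulfK// subr_eq0 gt_eqF.
move=> [[p q] [/= Ap Bq] <-]; have := AB _ _ Ap Bq => pq.
exists (fy p - slope p q * fx p); split; first by exists p.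
by exists q => //; rewrite /slope; field; rewrite subr_eq0 gt_eqF.
Qed.

Lemma slopes_neq0 A B : xlt A B -> slopes A B !=set0.
Proof.
move=> AB; rewrite slopesE//; move/asboolP: AB => [[p Ap] [q Bq] _].
by exists (slope p q), (p, q).
Qed.

(** The excess [g p q] of the rise from [p] to [q] over that of slope [m] is affine in the pair, at
    most 0 on the pair realising [m1] and at least 0 on the one realising [m2]. One weight [k], used
    in both bodies, makes it vanish. *)
Lemma slopes_itv A B : @convex_set R plane A -> @convex_set R plane B ->
  xlt A B -> is_interval (slopes A B).
Proof.
move=> /convex_setE cA /convex_setE cB /asboolP[_ _ AB] m1 m2.
move=> [_ [[p1 Ap1 <-] [q1 Bq1 e1]]] [_ [[p2 Ap2 <-] [q2 Bq2 e2]]] m.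
move=> /andP[m1m mm2].
have d1 := AB _ _ Ap1 Bq1; have d2 := AB _ _ Ap2 Bq2.
pose g p q := fy q - fy p - m * (fx q - fx p).
have [k k01 k0] : exists2 k, 0 <= k <= 1 & 0 = k * g p1 q1 + (1 - k) * g p2 q2.
  apply: convex_comb; rewrite /g; apply/andP; split; move: d1 d2 e1 e2; nra.
exists (fy (k *: p1 + (1 - k) *: p2) - m * fx (k *: p1 + (1 - k) *: p2)).
split; first by exists (k *: p1 + (1 - k) *: p2) => //; apply: cA.
exists (k *: q1 + (1 - k) *: q2); first exact: cB.
by rewrite !fx_comb !fy_comb;
  apply/eqP; rewrite -subr_eq0; apply/eqP; rewrite [RHS]k0 /g; ring.
Qed.

Lemma slope_continuous A B : xlt A B ->
  {within A `*` B, continuous (fun pq : plane * plane => slope pq.1 pq.2)}.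
Proof.
move=> /asboolP[_ _ AB]; apply: continuous_in_subspaceT => -[p q].
rewrite inE => -[/= Ap Bq]; have pq := AB _ _ Ap Bq.
have c1 i : {for (p, q), continuous (fun z : plane * plane => z.1 ord0 i)}.
  apply: (@continuous_comp _ _ _ fst (fun p : plane => p ord0 i)).
    exact: cvg_fst.
  exact: coord_continuous.
have c2 i : {for (p, q), continuous (fun z : plane * plane => z.2 ord0 i)}.
  apply: (@continuous_comp _ _ _ snd (fun p : plane => p ord0 i)).
    exact: cvg_snd.
  exact: coord_continuous.
rewrite /slope /fx /fy; apply: cvgM; first by apply: cvgB; [exact: c2|exact: c1].
apply: cvgV; first by rewrite subr_eq0 gt_eqF.
by apply: cvgB; [exact: c2|exact: c1].
Qed.

Lemma slopes_max A B : compact A -> compact B -> xlt A B ->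
  exists2 M, slopes A B M & forall m, slopes A B m -> m <= M.
Proof.
move=> kA kB AB; rewrite slopesE//.
have AB0 : A `*` B !=set0.
  by move/asboolP: AB => [[p Ap] [q Bq] _]; exists (p, q).
have [c /set_mem cAB cmax] :=
  compact_EVT_max AB0 (compact_setX kA kB) (slope_continuous AB).
exists (slope c.1 c.2); first by exists c.
by move=> _ [d dAB <-]; apply: cmax; rewrite inE.
Qed.

Lemma slopes_min A B : compact A -> compact B -> xlt A B ->
  exists2 M, slopes A B M & forall m, slopes A B m -> M <= m.
Proof.
move=> kA kB AB; rewrite slopesE//.
have AB0 : A `*` B !=set0.
  by move/asboolP: AB => [[p Ap] [q Bq] _]; exists (p, q).
have [c /set_mem cAB cmin] :=
  compact_EVT_min AB0 (compact_setX kA kB) (slope_continuous AB).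
exists (slope c.1 c.2); first by exists c.
by move=> _ [d dAB <-]; apply: cmin; rewrite inE.
Qed.

End Slopes.

(** * Hadwiger's transversal theorem *)

Section Transversals.
Variable R : realType.
Notation plane := 'rV[R]_2.
Implicit Types (p q r : plane) (A B C D : set plane) (m : R).

(** By compactness both slope intervals attain their extrema, so being disjoint they leave a gap of
    positive length; [m] is its midpoint. *)
Lemma slopes_gap A B C D : convex_body A -> convex_body B -> convex_body C ->
  convex_body D -> xlt A B -> xlt C D -> slopes A B `&` slopes C D = set0 ->
  exists m, [/\ ~ slopes A B m, ~ slopes C D m &
    forall I : set R, is_interval I -> slopes A B `&` I !=set0 ->
      slopes C D `&` I !=set0 -> I m].
Proof.
move=> + + + + AB CD.
wlog [x [y [ABx CDy xy]]] : A B C D AB CD /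
    exists x y, [/\ slopes A B x, slopes C D y & x < y].
  move=> H kA kB kC kD dis.
  have [x ABx] := slopes_neq0 AB; have [y CDy] := slopes_neq0 CD.
  case: (ltgtP x y) => [xy|yx|xy].
  - by apply: H => //; exists x, y.
  - have [||m [m1 m2 mP]] := H C D A B CD AB _ kC kD kA kB; last first.
    + by exists m; split=> // I iI h1 h2; apply: mP.
    + by rewrite setIC.
    + by exists y, x.
  - by suff : set0 x by []; rewrite -dis; split=> //; rewrite xy.
move=> [kA cA] [kB cB] [kC cC] [kD cD] dis.
have lt := interval_lt (slopes_itv cA cB AB) (slopes_itv cC cD CD) dis ABx CDy xy.
have [M ABM Mmax] := slopes_max kA kB AB.
have [N CDN Nmin] := slopes_min kC kD CD.
have MN : M < N by exact: lt.
exists ((M + N) / 2); split.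
- by move=> /Mmax; lra.
- by move=> /Nmin; lra.
- move=> I iI [z [/Mmax zM Iz]] [w [/Nmin Nw Iw]].
  by apply: (iI z w) => //; lra.
Qed.

Definition xsep A B := xlt A B || xlt B A.

Lemma xsepC A B : xsep A B = xsep B A.
Proof. by rewrite /xsep orbC. Qed.

Lemma xsep_slopes_neq0 A B : xsep A B -> slopes A B !=set0.
Proof. by move=> /orP[|]; [|rewrite slopesC]; exact: slopes_neq0. Qed.

Lemma xsep_slopes_itv A B : convex_body A -> convex_body B ->
  xsep A B -> is_interval (slopes A B).
Proof.
by move=> [_ cA] [_ cB] /orP[|]; [|rewrite slopesC]; exact: slopes_itv.
Qed.

(** For convex sets this says that a non-vertical line meets all three: shadows that pairwise meet
    in one direction share a point by Helly's theorem on the line. *)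
Definition stabbed A B C :=
  exists m, [/\ slopes A B m, slopes A C m & slopes B C m].

(* If the slopes of the common transversals of [A], [B] and those of [C], [D]
   are separated by [m], then in direction [m] the shadows of [A], [C], [B], [D]
   form a chordless 4-cycle. *)
Lemma slopes_meet A B C D : convex_body A -> convex_body B -> convex_body C ->
  convex_body D -> xsep A B -> xsep A C -> xsep A D -> xsep B C -> xsep B D ->
  xsep C D -> stabbed A B C -> stabbed A B D -> stabbed C D A -> stabbed C D B ->
  slopes A B `&` slopes C D !=set0.
Proof.
move=> kA kB kC kD sAB sAC sAD sBC sBD sCD [m1 [AB1 AC1 BC1]] [m2 [AB2 AD2 BD2]].
move=> [m3 [CD3 CA3 DA3]] [m4 [CD4 CB4 DB4]].
apply: contrapT => dis.
have {}dis : slopes A B `&` slopes C D = set0 by apply: contrapT => /eqP/set0P.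
have [m [ABm CDm mP]] : exists m, [/\ ~ slopes A B m, ~ slopes C D m &
    forall I : set R, is_interval I -> slopes A B `&` I !=set0 ->
      slopes C D `&` I !=set0 -> I m].
  case/orP: sAB => AB; case/orP: sCD => CD.
  - exact: slopes_gap.
  - by rewrite (slopesC C); apply: slopes_gap => //; rewrite (slopesC D).
  - by rewrite (slopesC A); apply: slopes_gap => //; rewrite (slopesC B).
  - rewrite (slopesC A) (slopesC C); apply: slopes_gap => //.
    by rewrite (slopesC B) (slopesC D).
apply: CDm; apply: (@interval_cycle4 _ (shadow m A) (shadow m B)).
- by apply: shadow_itv; case: kA.
- by apply: shadow_itv; case: kB.
- by apply: shadow_itv; case: kC.
- by apply: shadow_itv; case: kD.
(* [slopes A C] meets [slopes A B] at [m1] and [slopes C D] at [m3], so it contains [m]; likewise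
   for the other three mixed pairs. *)
- apply: (mP (slopes A C)); first exact: xsep_slopes_itv.
    by exists m1.
  by rewrite (slopesC A); exists m3.
- apply: (mP (slopes A D)); first exact: xsep_slopes_itv.
    by exists m2.
  by rewrite (slopesC A); exists m3.
- apply: (mP (slopes B C)); first exact: xsep_slopes_itv.
    by exists m1.
  by rewrite (slopesC B); exists m4.
- apply: (mP (slopes B D)); first exact: xsep_slopes_itv.
    by exists m2.
  by rewrite (slopesC B); exists m4.
- by apply: contrapT => /eqP/set0P.
Qed.

(* Hadwiger's transversal theorem: a line of slope [m] meeting all members
   exists iff the shadows in direction [m] pairwise meet, and the sets of slopes
   for which two given shadows meet are again intervals. *)
Lemma hadwiger (u : seq (set plane)) :
  {in u, forall A, convex_body A /\ A !=set0} ->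
  {in u &, forall A B, A != B -> xsep A B} ->
  {in u & &, forall A B C, A != B -> A != C -> B != C -> stabbed A B C} ->
  exists m b, {in u, forall A, shadow m A b}.
Proof.
move=> ku su tu.
have slopesxx A : A \in u -> slopes A A = setT.
  move=> /ku[_ [p Ap]]; apply/seteqP; split=> // m _.
  by exists (fy p - m * fx p); split; exists p.
(* Helly's theorem for the slope sets of all pairs. Two pairs sharing a set are handled by [stab],
   four distinct sets by [slopes_meet]. *)
have [m mP] : exists m,
    {in [seq (A, B) | A <- u, B <- u], forall AB, slopes AB.1 AB.2 m}.
  have slopes0 A B : A \in u -> B \in u -> slopes A B !=set0.
    move=> Au Bu; have [->|AB] := eqVneq A B; first by rewrite slopesxx//; exists 0.
    exact/xsep_slopes_neq0/su.
  apply: helly1 => [_ /allpairsP[[A B] [/= Au Bu ->]]/=|].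
    have [->|AB] := eqVneq A B; first by rewrite slopesxx.
    by apply: xsep_slopes_itv; [apply: (ku _ _).1|apply: (ku _ _).1|apply: su].
  move=> _ _ /allpairsP[[A B] [/= Au Bu ->]] /allpairsP[[C D] [/= Cu Du ->]]/=.
  have [AB|AB] := eqVneq A B.
    by rewrite -AB slopesxx// setTI; exact: slopes0.
  have [CD|CD] := eqVneq C D.
    by rewrite -CD slopesxx// setIT; exact: slopes0.
  have stab X Y Z : X \in u -> Y \in u -> Z \in u -> X != Y -> X != Z ->
      slopes X Y `&` slopes X Z !=set0.
    move=> Xu Yu Zu XY XZ; have [<-|YZ] := eqVneq Y Z.
      by rewrite setIid; exact: slopes0.
    by have [m [mXY mXZ _]] := tu _ _ _ Xu Yu Zu XY XZ YZ; exists m.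
  have [AC|AC] := eqVneq A C.
    by subst C; exact: stab.
  have [AD|AD] := eqVneq A D.
    by subst D; rewrite (slopesC C); exact: stab.
  have [BC|BC] := eqVneq B C.
    by subst C; rewrite (slopesC A); apply: stab => //; rewrite eq_sym.
  have [BD|BD] := eqVneq B D.
    by subst D; rewrite (slopesC A) (slopesC C); apply: stab => //; rewrite eq_sym.
  apply: slopes_meet; try (by apply: (ku _ _).1); try (by apply: su);
    by apply: tu; rewrite // eq_sym.
exists m; apply: helly1 => [A Au|A B Au Bu].
  by apply: shadow_itv; case: (ku A Au) => -[].
by apply: (mP (A, B)); apply/allpairsP; exists (A, B).
Qed.

Definition mkpoint (x y : R) : plane := \row_(i < 2) (if i == ord0 then x else y).

Lemma fx_mkpoint x y : fx (mkpoint x y) = x.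
Proof. by rewrite /fx mxE. Qed.

Lemma fy_mkpoint x y : fy (mkpoint x y) = y.
Proof. by rewrite /fy mxE. Qed.

Lemma point_eq p q : fx p = fx q -> fy p = fy q -> p = q.
Proof.
move=> xpq ypq; apply/rowP => -[[|[|//]] i].
  by rewrite (_ : Ordinal i = ord0); [exact: xpq | exact: val_inj].
by rewrite (_ : Ordinal i = ord_max); [exact: ypq | exact: val_inj].
Qed.

Lemma shadow_transversal (G : set (set plane)) m b :
  (forall A, G A -> shadow m A b) -> exists l, transversal_line G l.
Proof.
move=> GA; exists [set mkpoint 0 b + s *: mkpoint 1 m | s in [set: R]]; split.
  exists (mkpoint 0 b), (mkpoint 1 m); split=> //.
  apply/eqP => /(congr1 (@fx R)); rewrite fx_mkpoint /fx mxE => /eqP.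
  by rewrite oner_eq0.
move=> A /GA[p Ap <-]; exists p; split=> //; exists (fx p) => //.
rewrite -[mkpoint 0 _]scale1r.
by apply: point_eq; rewrite ?fx_comb ?fy_comb ?fx_mkpoint ?fy_mkpoint; ring.
Qed.

Lemma vertical_transversal (G : set (set plane)) x :
  (forall A, G A -> (@fx R @` A) x) -> exists l, transversal_line G l.
Proof.
move=> GA; exists [set mkpoint x 0 + s *: mkpoint 0 1 | s in [set: R]]; split.
  exists (mkpoint x 0), (mkpoint 0 1); split=> //.
  apply/eqP => /(congr1 (@fy R)); rewrite fy_mkpoint /fy mxE => /eqP.
  by rewrite oner_eq0.
move=> A /GA[p Ap xp]; exists p; split=> //; exists (fy p) => //.
rewrite -[mkpoint x _]scale1r.
by apply: point_eq; rewrite ?fx_comb ?fy_comb ?fx_mkpoint ?fy_mkpoint -?xp; ring.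
Qed.

(** * Orientation and convex position *)

(** Twice the signed area of the triangle, positive when [p], [q], [r] turn counterclockwise. *)
Definition det p q r :=
  (fx q - fx p) * (fy r - fy p) - (fy q - fy p) * (fx r - fx p).

Definition collinear A B C :=
  exists p q r, [/\ A p, B q, C r & det p q r = 0].

Lemma collinear_stabbed A B C :
  xlt A B -> collinear A B C -> stabbed A B C.
Proof.
move=> /asboolP[_ _ AB] [p [q [r [Ap Bq Cr d]]]].
have pq := AB _ _ Ap Bq; have pq0 : fx q - fx p != 0 by rewrite subr_eq0 gt_eqF.
exists (slope p q); set b := fy p - slope p q * fx p.
have bA : shadow (slope p q) A b by exists p.
have bB : shadow (slope p q) B b.
  by exists q => //; rewrite /b /slope; field.
have bC : shadow (slope p q) C b.
  exists r => //; apply/eqP; rewrite /b -subr_eq0; apply/eqP.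
  (* The vertical offset of [r] from the line through [p] and [q] is [det p q r / (fx q - fx p)]. *)
  rewrite -[RHS](mul0r (fx q - fx p)^-1) -[in RHS]d /det /slope.
  by field.
by split; exists b.
Qed.

Lemma affine_pos f A p q : affine f -> @convex_set R plane A ->
  (forall r, A r -> f r != 0) -> A p -> A q -> 0 < f p -> 0 < f q.
Proof.
move=> af cA f0 Ap Aq fp; rewrite ltNge; apply/negP => fq.
have [r Ar r0] : (f @` A) 0.
  by apply: (affine_itv af cA (x := f q) (y := f p));
    [exists q|exists p|rewrite fq ltW].
by have := f0 _ Ar; rewrite r0 eqxx.
Qed.

(** [det] is affine in each point and never 0 on the three sets, so its sign survives moving the
    points one at a time. *)
Lemma det_pos A B C p q r p' q' r' : @convex_set R plane A ->
  @convex_set R plane B -> @convex_set R plane C -> ~ collinear A B C ->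
  A p -> B q -> C r -> A p' -> B q' -> C r' ->
  0 < det p q r -> 0 < det p' q' r'.
Proof.
move=> cA cB cC ncol Ap Bq Cr Ap' Bq' Cr' d.
have d0 x y z : A x -> B y -> C z -> det x y z != 0.
  by move=> Ax By Cz; apply/eqP => xyz; apply: ncol; exists x, y, z.
have d1 : 0 < det p' q r.
  apply: (@affine_pos (fun x => det x q r) A p) => //;
    last by move=> x Ax; exact: d0.
  by move=> k x y; rewrite /det !fx_comb !fy_comb; ring.
have d2 : 0 < det p' q' r.
  apply: (@affine_pos (fun x => det p' x r) B q) => //;
    last by move=> x Ax; exact: d0.
  by move=> k x y; rewrite /det !fx_comb !fy_comb; ring.
apply: (@affine_pos (fun x => det p' q' x) C r) => //;
  last by move=> x Ax; exact: d0.
by move=> k x y; rewrite /det !fx_comb !fy_comb; ring.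
Qed.

(** For independent [f] and [g], an open half-plane with an open ray of its boundary. It excludes a
    point [p] with [f p = g p = 0] even when the set to be separated from [p] touches the line
    [f = 0] on one side of [p]. *)
Lemma lex_halfplane_convex f g : affine f -> affine g ->
  @convex_set R plane [set z | f z < 0 \/ (f z = 0 /\ g z < 0)].
Proof.
move=> af ag; apply/convex_setE => p q k /andP[k0 k1] /= fp fq.
rewrite af ag.
have [->|kn0] := eqVneq k 0.
  by rewrite subr0 !mul0r !mul1r !add0r.
have [->|kn1] := eqVneq k 1.
  by rewrite subrr !mul0r !mul1r !addr0.
have {}k0 : 0 < k by rewrite lt_neqAle eq_sym kn0.
have {}k1 : k < 1 by rewrite lt_neqAle kn1.
case: fp => [fp|[fp gp]]; case: fq => [fq|[fq gq]].
- by left; nra.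
- by left; rewrite fq; nra.
- by left; rewrite fp; nra.
- by right; rewrite fp fq !mulr0 addr0; split=> //; nra.
Qed.

Lemma not_conv_hull (S T : set plane) p : @convex_set R plane T -> S `<=` T ->
  ~ T p -> ~ conv_hull S p.
Proof. by move=> cT ST nT /(_ T (conj cT ST)). Qed.

Lemma affine_halfplane (a b c : R) : affine (fun z => a * fx z + b * fy z + c).
Proof. by move=> k p q; rewrite fx_comb fy_comb; ring. Qed.

(* The slopes at [p] of the points to the left of [p] lie strictly on one side
   of the slopes of the points to the right, so a line through [p] separates. *)
Lemma notin_conv_hull_convex_chain (S : set plane) p (e : R) :
  (forall q, S q -> fx q != fx p) ->
  (forall q r, S q -> S r -> fx q < fx p -> fx p < fx r -> 0 < e * det q p r) ->
  ~ conv_hull S p.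
Proof.
move=> Sp Sdet.
have sep f g : affine f -> affine g ->
    (forall q, S q -> f q < 0 \/ (f q = 0 /\ g q < 0)) -> f p = 0 -> g p = 0 ->
    ~ conv_hull S p.
  move=> af ag Sfg fp gp.
  apply: (not_conv_hull (lex_halfplane_convex af ag) Sfg) => /=.
  by rewrite fp gp !ltxx; case=> // -[].
have [[q0 [Sq0 q0p]]|noleft] := pselect (exists q, S q /\ fx q < fx p); last first.
  apply: (sep (fun z => (-1) * fx z + 0 * fy z + fx p)
    (fun z => 0 * fx z + 0 * fy z + 0)).
  - exact: affine_halfplane.
  - exact: affine_halfplane.
  - move=> q Sq; left; have := Sp _ Sq; rewrite neq_lt => /orP[qp|]; last by lra.
    by exfalso; apply: noleft; exists q.
  - by ring.
  - by ring.
have [[r0 [Sr0 pr0]]|noright] := pselect (exists q, S q /\ fx p < fx q); last first.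
  apply: (sep (fun z => 1 * fx z + 0 * fy z + - fx p)
    (fun z => 0 * fx z + 0 * fy z + 0)).
  - exact: affine_halfplane.
  - exact: affine_halfplane.
  - move=> q Sq; left; have := Sp _ Sq; rewrite neq_lt => /orP[|qp]; first by lra.
    by exfalso; apply: noright; exists q.
  - by ring.
  - by ring.
pose sl q := e * slope p q.
(* The factor [e] treats convex and concave chains alike: scaled slopes on the left stay below those
   on the right. *)
have sl_lt q r : S q -> S r -> fx q < fx p -> fx p < fx r -> sl q < sl r.
  move=> Sq Sr qp pr; have d := Sdet _ _ Sq Sr qp pr; rewrite -subr_gt0.
  have q0' : fx q - fx p < 0 by lra.
  have r0' : 0 < fx r - fx p by lra.
  have -> : sl r - sl q = e * det q p r / ((fx p - fx q) * (fx r - fx p)).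
    rewrite /sl /slope /det; field.
    by rewrite !subr_eq0 ?(gt_eqF pr) ?(gt_eqF qp) ?(lt_eqF qp).
  by rewrite divr_gt0// mulr_gt0// subr_gt0.
pose L := [set sl q | q in [set q | S q /\ fx q < fx p]].
have L0 : L !=set0 by exists (sl q0), q0.
have Lub r : S r -> fx p < fx r -> ubound L (sl r).
  by move=> Sr pr _ [q [Sq qp] <-]; apply/ltW/sl_lt.
pose m := sup L.
have mleft q : S q -> fx q < fx p -> sl q <= m.
  by move=> Sq qp; apply: ub_le_sup; [exists (sl r0); exact: Lub | exists q].
have mright r : S r -> fx p < fx r -> m <= sl r.
  by move=> Sr pr; apply: ge_sup => //; exact: Lub.
(* The line through [p] with scaled slope [m]. By [fE] below, [f] is at most 0 on both sides of
   [p]. *)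
pose f z := m * fx z + (- e) * fy z + (e * fy p - m * fx p).
have fE z : fx z != fx p -> f z = (m - sl z) * (fx z - fx p).
  by move=> zp; rewrite /f /sl /slope; field; rewrite subr_eq0.
have fp0 : f p = 0 by rewrite /f; ring.
(* If the supremum [m] is attained, [S] touches the line only to the left of [p]; otherwise only to
   the right. This decides the sign of the second function. *)
have [[q1 [Sq1 q1p fq1]]|fleft] :=
    pselect (exists q, [/\ S q, fx q < fx p & m = sl q]).
  apply: (sep f (fun z => 1 * fx z + 0 * fy z + - fx p)) => //.
  - exact: affine_halfplane.
  - exact: affine_halfplane.
  - move=> q Sq; have qp := Sp _ Sq; rewrite fE//.
    move: (qp); rewrite neq_lt => /orP[ltqp|ltpq]; last first.
      by left; have := sl_lt _ _ Sq1 Sq q1p ltpq; rewrite -fq1; nra.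
    have := mleft _ Sq ltqp; rewrite le_eqVlt => /predU1P[->|]; last by left; nra.
    by right; rewrite subrr mul0r; split=> //; lra.
  - by ring.
apply: (sep f (fun z => (-1) * fx z + 0 * fy z + fx p)) => //.
- exact: affine_halfplane.
- exact: affine_halfplane.
- move=> q Sq; have qp := Sp _ Sq; rewrite fE//.
  move: (qp); rewrite neq_lt => /orP[ltqp|ltpq].
    left; have := mleft _ Sq ltqp; rewrite le_eqVlt => /predU1P[mq|]; last by nra.
    by exfalso; apply: fleft; exists q; split.
  have := mright _ Sq ltpq; rewrite le_eqVlt => /predU1P[->|]; last by left; nra.
  by right; rewrite subrr mul0r; split=> //; lra.
- by ring.
Qed.

End Transversals.

(** * Bodies listed from left to right *)

Section Chains.
Variable R : realType.
Notation plane := 'rV[R]_2.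
Implicit Types (p q r : plane) (A B C : set plane).

(** A list sorted by an irreflexive transitive relation is determined by its members, so [s] is [u]
    filtered by membership in [s]. *)
Lemma xlt_sorted_subseq (s u : seq (set plane)) :
  sorted (@xlt R) s -> sorted (@xlt R) u -> {subset s <= u} -> subseq s u.
Proof.
move=> ss su sub; suff -> : s = [seq A <- u | A \in s] by exact: filter_subseq.
apply: (irr_sorted_eq (@xlt_trans R) (@xlt_irr R)) => //.
  exact: (sorted_filter (@xlt_trans R)).
move=> A; rewrite mem_filter andbC; case: (boolP (A \in s)) => As;
  rewrite ?andbF//.
by rewrite sub.
Qed.

Lemma sorted_xsep (u : seq (set plane)) : sorted (@xlt R) u ->
  {in u &, forall A B, A != B -> xsep A B}.
Proof.
rewrite (sorted_pairwise (@xlt_trans R)); elim: u => //= X u IHu.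
move=> /andP[/allP Xu su] A B.
rewrite !inE => /predU1P[->|Au] /predU1P[->|Bu]; first by rewrite eqxx.
- by rewrite /xsep Xu.
- by rewrite /xsep Xu// orbT.
- exact: IHu.
Qed.

Lemma xsep_lt A B p q : xsep A B -> A p -> B q -> fx p < fx q -> xlt A B.
Proof.
move=> /orP[//|/asboolP[_ _ BA]] Ap Bq pq.
by have := BA _ _ Bq Ap; rewrite ltNge ltW.
Qed.

Lemma xsep_fx A B p q : xsep A B -> A p -> B q -> fx p != fx q.
Proof.
move=> /orP[|] /asboolP[_ _ AB] Ap Bq; first by rewrite lt_eqF// AB.
by rewrite gt_eqF// AB.
Qed.

(** Any point [p] of [A] witnesses that the hulls differ: the other bodies lie to its left or right,
    with orientations that keep [p] out of their hull. *)
Lemma convex_chain_position (u : seq (set plane)) (e : R) : sorted (@xlt R) u ->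
  {in u, forall A, A !=set0} ->
  {in u & &, forall A B C, xlt A B -> xlt B C ->
     forall p q r, A p -> B q -> C r -> 0 < e * det p q r} ->
  convex_position [set` u].
Proof.
move=> su u0 ude A /= Au; have [p Ap] := u0 _ Au => eqhull.
have : conv_hull (\bigcup_(B in [set` u]) B) p.
  by apply: sub_gen_smallest; exists A.
rewrite eqhull; apply: (@notin_conv_hull_convex_chain _ _ _ e).
  move=> q [B [/= Bu /eqP BA] Bq]; apply: (xsep_fx (A := B) (B := A)) => //.
  exact: sorted_xsep su _ _ Bu Au BA.
move=> q r [B [/= Bu /eqP BA] Bq] [C [/= Cu /eqP CA] Cr] qp pr.
apply: (ude B A C) => //.
  by apply: (xsep_lt (p := q) (q := p)) => //; exact: sorted_xsep su _ _ Bu Au BA.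
apply: (xsep_lt (p := p) (q := r)) => //.
by rewrite xsepC; exact: sorted_xsep su _ _ Cu Au CA.
Qed.

Lemma disjoint_xsep A B : @convex_set R plane A -> @convex_set R plane B ->
  A !=set0 -> B !=set0 -> ~ ((@fx R @` A) `&` (@fx R @` B) !=set0) -> xsep A B.
Proof.
move=> cA cB A0 B0 AB.
have {}AB : (@fx R @` A) `&` (@fx R @` B) = set0 by apply: contrapT => /eqP/set0P.
have iA := affine_itv (@fx_affine R) cA; have iB := affine_itv (@fx_affine R) cB.
have [p Ap] := A0; have [q Bq] := B0.
have imA x : A x -> (@fx R @` A) (fx x) by move=> Ax; exists x.
have imB x : B x -> (@fx R @` B) (fx x) by move=> Bx; exists x.
apply/orP; case: (ltgtP (fx p) (fx q)) => [pq|qp|pq].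
- left; apply/asboolP; split=> // p' q' Ap' Bq'.
  exact: (interval_lt iA iB AB (imA _ Ap) (imB _ Bq) pq (imA _ Ap') (imB _ Bq')).
- right; rewrite setIC in AB; apply/asboolP; split=> // q' p' Bq' Ap'.
  exact: (interval_lt iB iA AB (imB _ Bq) (imA _ Ap) qp (imB _ Bq') (imA _ Ap')).
- suff : set0 (fx p) by [].
  by rewrite -AB; split; [exact: imA | rewrite pq; exact: imB].
Qed.

Lemma seq_of_card_le (F : set (set plane)) h : `I_h #<= F ->
  exists s : seq (set plane), [/\ uniq s, size s = h & {in s, forall x, F x}].
Proof.
move=> /pcard_leP/injfunPex[f fF finj]; exists [seq f i | i <- iota 0 h]; split.
- rewrite map_inj_in_uniq ?iota_uniq// => i j.
  by rewrite !mem_iota/= !add0n => ih jh; apply: finj; rewrite inE.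
- by rewrite size_map size_iota.
- by move=> x /mapP[i]; rewrite mem_iota/= add0n => ih ->; exact: fF.
Qed.

(* Colourings for Ramsey's theorem; the value on lists of the wrong length is
   irrelevant. *)
Definition xmeet (s : seq (set plane)) :=
  if s is [:: A; B] then `[< (@fx R @` A) `&` (@fx R @` B) !=set0 >] else true.

Definition xltb (s : seq (set plane)) :=
  if s is [:: A; B] then xlt A B else true.

Definition collinearb (s : seq (set plane)) :=
  if s is [:: A; B; C] then `[< collinear A B C >] else true.

Definition ccw (s : seq (set plane)) :=
  if s is [:: A; B; C]
  then `[< forall p q r, A p -> B q -> C r -> 0 < det p q r >] else true.

Lemma xmeet_transversal (u : seq (set plane)) :
  {in u, forall A, convex_body A /\ A !=set0} -> homogeneous 2 xmeet u ->
  exists l, transversal_line [set` u] l.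
Proof.
move=> ku /homogeneous2 mu.
have [x xP] : exists x, {in u, forall A, (@fx R @` A) x}.
  apply: (helly1 (I := fun A => @fx R @` A)).
    by move=> A /ku[[_ cA] _]; exact: affine_itv (@fx_affine R) cA.
  have := pairwise_sym_in _ _ mu => /(_ _ _) H A B Au Bu.
  apply/asboolP; apply: H => // [X Y|X /ku[_ [p Xp]]]; first by rewrite /= setIC.
  by apply/asboolP; rewrite setIid; exists (fx p), p.
exact: vertical_transversal xP.
Qed.

(** Disjoint projections make the bodies comparable, but [s] lists them in arbitrary order. Ramsey's
    theorem finds an increasing or a decreasing sublist; the latter is reversed, hence an inclusion
    of members instead of [subseq]. *)
Lemma not_xmeet_sorted N : exists M, forall s : seq (set plane),
  {in s, forall A, convex_body A /\ A !=set0} -> homogeneous 2 (predC xmeet) s ->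
  (M <= size s)%N ->
  exists u, [/\ {subset u <= s}, size u = N & sorted (@xlt R) u].
Proof.
have [M HM] := ramsey 2 N N; exists M => s ks ms Ms.
have [u us [[uN]|[uN]]] := HM _ xltb s Ms.
  move=> /homogeneous2 lu; exists u; split=> //; first exact: mem_subseq.
  by rewrite (sorted_pairwise (@xlt_trans R)).
move=> nlu; exists (rev u); split; last first.
- rewrite rev_sorted; apply: pairwise_sorted.
  have /homogeneous2 : homogeneous 2
      (fun w => if w is [:: A; B] then xlt B A else true) u.
    move=> [|A [|B [|//]]]//= ABu _.
    have /= := nlu _ ABu erefl; have /= := ms _ (subseq_trans ABu us) erefl.
    move=> /asboolPn dis /negbTE AB.
    have [[_ cA] A0] : convex_body A /\ A !=set0.
      by apply/ks/(mem_subseq us)/(mem_subseq ABu); rewrite mem_head.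
    have [[_ cB] B0] : convex_body B /\ B !=set0.
      by apply/ks/(mem_subseq us)/(mem_subseq ABu); rewrite !inE eqxx orbT.
    by have := disjoint_xsep cA cB A0 B0 dis; rewrite /xsep AB.
  by [].
- by rewrite size_rev.
- by move=> A; rewrite mem_rev; exact: mem_subseq.
Qed.

Lemma xlt_chain3 (u : seq (set plane)) A B C : sorted (@xlt R) u ->
  A \in u -> B \in u -> C \in u -> xlt A B -> xlt B C ->
  subseq [:: A; B; C] u.
Proof.
move=> su Au Bu Cu AB BC; apply: xlt_sorted_subseq => //; first by rewrite /= AB BC.
by move=> X; rewrite !inE => /or3P[] /eqP ->.
Qed.

Lemma stabbed_213 A B C : stabbed A B C -> stabbed B A C.
Proof. by move=> [m [mAB mAC mBC]]; exists m; rewrite (slopesC B A). Qed.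

Lemma stabbed_132 A B C : stabbed A B C -> stabbed A C B.
Proof. by move=> [m [mAB mAC mBC]]; exists m; rewrite (slopesC C B). Qed.

Lemma collinear_transversal (u : seq (set plane)) :
  {in u, forall A, convex_body A /\ A !=set0} -> sorted (@xlt R) u ->
  homogeneous 3 collinearb u -> exists l, transversal_line [set` u] l.
Proof.
move=> ku su cu.
have chain A B C : A \in u -> B \in u -> C \in u -> xlt A B -> xlt B C ->
    stabbed A B C.
  move=> Au Bu Cu AB BC; apply: collinear_stabbed => //; apply/asboolP.
  exact: cu (xlt_chain3 su Au Bu Cu AB BC) erefl.
have [|m [b mb]] := hadwiger ku (sorted_xsep su); last exact: shadow_transversal mb.
move=> A B C Au Bu Cu AB AC BC.
have sAB := sorted_xsep su Au Bu AB; have sAC := sorted_xsep su Au Cu AC.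
have sBC := sorted_xsep su Bu Cu BC.
(* Homogeneity covers triples in left-to-right order only; the symmetry of [stabbed] reduces every
   other order to it. *)
wlog ltAB : A B Au Bu AB AC BC sAB sAC sBC / xlt A B.
  move=> H; case/orP: (sAB) => lt; first exact: H.
  by apply: stabbed_213; apply: H; rewrite // 1?eq_sym 1?xsepC.
case/orP: sBC => [ltBC|ltCB]; first exact: chain.
apply: stabbed_132; case/orP: sAC => [ltAC|ltCA]; first exact: chain.
by apply: stabbed_213; exact: chain.
Qed.

Lemma not_collinear_position n : exists M, forall s : seq (set plane),
  {in s, forall A, convex_body A /\ A !=set0} -> sorted (@xlt R) s ->
  homogeneous 3 (predC collinearb) s -> (M <= size s)%N ->
  exists u, [/\ subseq u s, size u = n & convex_position [set` u]].
Proof.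
have [M HM] := ramsey 3 n n; exists M => s ks ss cs Ms.
have [u us uP] := HM _ ccw s Ms.
have su := subseq_sorted (@xlt_trans R) us ss.
have ku A : A \in u -> convex_body A /\ A !=set0.
  by move=> Au; apply: ks; exact: mem_subseq us _ Au.
have u0 : {in u, forall A, A !=set0} by move=> A /ku[].
exists u; case: uP => [[un pu]|[un nu]]; split=> //.
  apply: (@convex_chain_position _ 1) => // A B C Au Bu Cu AB BC p q r Ap Bq Cr.
  have /= /asboolP := pu _ (xlt_chain3 su Au Bu Cu AB BC) erefl.
  by rewrite mul1r; apply.
apply: (@convex_chain_position _ (-1)) => // A B C Au Bu Cu AB BC p q r Ap Bq Cr.
have ABCu := xlt_chain3 su Au Bu Cu AB BC.
have /= /asboolPn ncol := cs _ (subseq_trans ABCu us) erefl.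
have /= /asboolPn nccw := nu _ ABCu erefl.
(* The colour only denies that all triples of points are counterclockwise. One such triple would
   make all of them so by [det_pos], and a zero determinant would make the bodies collinear. *)
rewrite mulN1r oppr_gt0 ltNge le_eqVlt; apply/negP => /predU1P[d|d].
  by apply: ncol; exists p, q, r.
apply: nccw => p' q' r' Ap' Bq' Cr'.
have [[_ cA] _] := ku _ Au; have [[_ cB] _] := ku _ Bu; have [[_ cC] _] := ku _ Cu.
exact: (det_pos cA cB cC ncol Ap Bq Cr).
Qed.

End Chains.

(** * Assembly of the four applications of Ramsey's theorem *)

Theorem theorem4 (R : realType) (t n : nat) (ht : (3 <= t)%N) (hn : (3 <= n)%N) :
  exists h : nat, forall F : set (set 'rV[R]_2),
    (forall K, F K -> convex_body K) ->
    `I_h.+1 #<= F ->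
    (exists G : set (set 'rV[R]_2),
       [/\ G `<=` F, G #= `I_t & exists l : set 'rV[R]_2, transversal_line G l])
    \/
    (exists G : set (set 'rV[R]_2),
       [/\ G `<=` F, G #= `I_n & convex_position G]).
Proof.
(* The bounds are fixed backwards, from the last extraction to the first. *)
have [N4 H4] := not_collinear_position R n.
have [N3 H3] := ramsey 3 t N4.
have [N2 H2] := not_xmeet_sorted R N3.
have [N1 H1] := ramsey 2 t N2.
exists N1 => F kF /seq_of_card_le[s0 [us0 ss0 s0F]].
(* The empty set may be among the [N1.+1] bodies; at least [N1] remain without it. *)
pose s := [seq A <- s0 | A != set0].
have us : uniq s by exact: filter_uniq.
have ks : {in s, forall A, convex_body A /\ A !=set0}.
  by move=> A; rewrite mem_filter => /andP[/set0P A0 /s0F/kF].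
have sF : {in s, forall A, F A}.
  by move=> A; rewrite mem_filter => /andP[_]; exact: s0F.
have N1s : (N1 <= size s)%N by have := size_filter_neq set0 us0; rewrite ss0.
have [s1 s1s [[s1t m1]|[s1N m1]]] := H1 _ (@xmeet R) s N1s.
  left; exists [set` s1]; split.
  - by move=> A /= As1; apply/sF/(mem_subseq s1s).
  - by rewrite -s1t; apply/card_seq/(subseq_uniq s1s).
  - by apply: xmeet_transversal => // A As1; apply/ks/(mem_subseq s1s).
have ks1 : {in s1, forall A, convex_body A /\ A !=set0}.
  by move=> A As1; apply/ks/(mem_subseq s1s).
have [|s2 [s2s1 s2N ss2]] := H2 s1 ks1 m1; first by rewrite s1N.
have ks2 : {in s2, forall A, convex_body A /\ A !=set0}.
  by move=> A As2; apply/ks1/s2s1.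
have us2 : uniq s2 := sorted_uniq (@xlt_trans R) (@xlt_irr R) ss2.
have s2F : {in s2, forall A, F A}.
  by move=> A As2; apply/sF/(mem_subseq s1s)/s2s1.
have [|s3 s3s2 [[s3t c3]|[s3N c3]]] := H3 _ (@collinearb R) s2; first by rewrite s2N.
  left; exists [set` s3]; split.
  - by move=> A /= As3; apply/s2F/(mem_subseq s3s2).
  - by rewrite -s3t; apply/card_seq/(subseq_uniq s3s2).
  - apply: collinear_transversal => // [A As3|]; first exact/ks2/(mem_subseq s3s2).
    exact: subseq_sorted (@xlt_trans R) _ _ s3s2 ss2.
have [A As3||s4 [s4s3 s4n c4]] := H4 s3 _ (subseq_sorted (@xlt_trans R) s3s2 ss2) c3.
- exact/ks2/(mem_subseq s3s2).
- by rewrite s3N.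
right; exists [set` s4]; split=> //.
- by move=> A /= As4; apply/s2F/(mem_subseq s3s2)/(mem_subseq s4s3).
- by rewrite -s4n; apply/card_seq/(subseq_uniq s4s3)/(subseq_uniq s3s2).
Qed.
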